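(* Let $\mathcal M$ be the mapping class group of $\Sigma=\Sigma_{g,1}$ with its $\mathbb Z^2$-indexed filtration $(\mathcal M_{m,n})_{(m,n)\in\mathbb Z^2}$, and let $(\mathcal G_{m,n})_{(m,n)\in\mathbb N^2}$ be the double Johnson filtration of the Goeritz group $\mathcal G$. Then $\mathcal M_{m,n}=\mathcal G_{m,n}$ for all $(m,n)\in\mathbb N^2$. In particular, $\mathcal M_{0,0}=\mathcal G_{0,0}=\mathcal G$.
   Context: Let $g\ge0$ be an integer and $\mathbb N=\{0,1,2,\dots\}$. Let $S^3=V\cup V'$ be the standard Heegaard splitting of genus $g$ ($V,V'$ handlebodies of genus $g$ with $\partial V=\partial V'$). Fix a disk $D\subset\partial V$, and let $\Sigma$ be the compact connected oriented surface of genus $g$ with one boundary component such that $\partial V=\Sigma\cup D$; fix $*\in\partial\Sigma$. Let $K=\pi_1(\Sigma,* )$, which is free of rank $2g$, with free basis $\{x_i,y_i\}_{1\le i\le g}$ given by the standard meridians $x_i$ (bounding disks in $V$) and parallels $y_i$ (bounding disks in $V'$), and let $\bar X=\ker(K\to\pi_1(V,* ))=\langle\langle x_1,\dots,x_g\rangle\rangle_K$ and $\bar Y=\ker(K\to\pi_1(V',* ))=\langle\langle y_1,\dots,y_g\rangle\rangle_K$ (normal closures). $\mathcal M$ is the group of isotopy classes of orientation-preserving homeomorphisms of $\Sigma$ fixing $\partial\Sigma$ pointwise; it acts on $K$. Write $[a,b]=aba^{-1}b^{-1}$, $[h,k]=h(k)k^{-1}$ for $h\in\mathcal M$, $k\in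 K$, and $[h,S]\subset T$ if $[h,s]\in T$ for all $s\in S$. For subgroups $S,T$ of a group, $[S,T]$ is the subgroup generated by all $[s,t]$ with $s\in S$, $t\in T$. $\Gamma_n$ denotes the $n$-th term of the lower central series ($\Gamma_1G=G$). Double lower central series of $(K;\bar X,\bar Y)$: $K_{0,0}=K$, $K_{m,0}=\Gamma_m\bar X$ and $K_{0,n}=\Gamma_n\bar Y$ for $m,n\ge1$, $K_{m,n}=[K_{1,0},K_{m-1,n}][K_{0,1},K_{m,n-1}]$ for $m,n\ge1$; extended by $K_{m,n}=K_{\max(0,m),\max(0,n)}$ for $(m,n)\in\mathbb Z^2$. Goeritz group: $\mathcal G=\{h\in\mathcal M\mid h(\bar X)=\bar X,\ h(\bar Y)=\bar Y\}$. Its double Johnson filtration is $\mathcal G_{m,n}=\{h\in\mathcal G\mid[h,K_{i,j}]\subset K_{m+i,n+j}\text{ for all }(i,j)\in\mathbb N^2\}$ for $(m,n)\in\mathbb N^2$. Filtration of $\mathcal M$: for $(m,n)\in\mathbb Z^2$, $\mathcal M_{m,n}=\{h\in\mathcal M\mid[h^{\pm1},K_{i,j}]\subset K_{m+i,n+j}\text{ for every }(i,j)\in\mathbb N^2\}$. *)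

(* Defs.v *)
From HB Require Import structures.
From mathcomp Require Import all_boot all_order all_algebra generic_quotient.
From mathcomp Require Import all_classical all_reals all_analysis.
From mathcomp Require Import homotopy lra.

Set Implicit Arguments.
Unset Strict Implicit.
Unset Printing Implicit Defensive.

Import Order.TTheory GRing.Theory Num.Theory.
Import numFieldNormedType.Exports.

Local Open Scope classical_set_scope.
Local Open Scope ring_scope.
Local Open Scope quotient_scope.

Definition itv01 (R : realType) : Type := set_type `[0%R, 1%R : R]%classic.

Section unit_interval.
Context {R : realType}.
Local Notation I := (itv01 R).

HB.instance Definition _ :=
  Topological.copy I (set_type `[0%R, 1%R : R]%classic).

(* The retraction of R onto the unit interval. *)
Lemma clamp01_subproof (r : R) :
  Num.max 0 (Num.min 1 r) \in (`[0%R, 1%R : R]%classic : set R).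
Proof.
rewrite mem_setE in_itv /= le_max lexx /=.
by rewrite ge_max ler01 /= ge_min lexx.
Qed.

Definition clamp01 (r : R) : I := SigSub (clamp01_subproof r).

Lemma set_val_clamp01 (r : R) :
  set_val (clamp01 r) = Num.max 0 (Num.min 1 r).
Proof. by rewrite set_valE. Qed.

Lemma val_clamp01 (r : R) : 0 <= r <= 1 -> set_val (clamp01 r) = r.
Proof.
by case/andP=> r0 r1; rewrite set_val_clamp01 (min_idPr r1) (max_idPr r0).
Qed.

Lemma itv01P (t : I) : 0 <= (set_val t : R) <= 1.
Proof. by have := set_valP t; rewrite /= in_itv. Qed.

Lemma set_val01_inj : injective (set_val : I -> R).
Proof. by move=> s t; rewrite !set_valE => /val_inj. Qed.

Lemma clamp01K (t : I) : clamp01 (set_val t) = t.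
Proof. exact/set_val01_inj/val_clamp01/itv01P. Qed.

Lemma cont_val01 : continuous (set_val : I -> R).
Proof. exact: initial_continuous. Qed.

Lemma cont_clamp01 : continuous clamp01.
Proof.
apply: continuous_comp_initial => x /=.
apply: (@continuous_max R R (cst 0) (fun r : R => Num.min 1 r)).
  exact: cvg_cst.
by apply: (@continuous_min R R (cst 1) id); [exact: cvg_cst | exact: cvg_id].
Qed.

Lemma itv01_neq : clamp01 0 != clamp01 1 :> I.
Proof.
apply/eqP => /(congr1 (set_val : I -> R)).
rewrite !val_clamp01 ?lexx ?ler01 //.
by move/eqP; rewrite eq_sym oner_eq0.
Qed.

HB.instance Definition _ :=
  isBiPointed.Build I itv01_neq.

Lemma val_zero01 : set_val (zero : I) = 0.
Proof. by rewrite val_clamp01 // lexx ler01. Qed.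

Lemma val_one01 : set_val (one : I) = 1.
Proof. by rewrite val_clamp01 // lexx ler01. Qed.

Lemma pasting (X U : topologicalType) (c : X -> R) (F G : X -> U) :
  continuous c -> continuous F -> continuous G ->
  (forall x, c x = 1/2 -> F x = G x) ->
  continuous (fun x => if c x <= 1/2 then F x else G x).
Proof.
move=> cc cF cG FG; apply/continuous_subspace_setT.
have -> : [set: X] = (c @^-1` [set r | r <= 1/2]) `|` (c @^-1` [set r | 1/2 <= r]).
  by apply/seteqP; split=> // x _ /=; case: (leP (c x) (1/2)) => [|/ltW]; [left|right].
apply: withinU_continuous.
- by apply: preimage_closed => // x _; exact: cc.
- by apply: preimage_closed => // x _; exact: cc.
- apply: (subspace_eq_continuous _ (continuous_subspaceT cF)).
  by move=> x /set_mem /= hx; rewrite /from_subspace /= hx.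
- apply: (subspace_eq_continuous _ (continuous_subspaceT cG)).
  move=> x /set_mem /= hx; rewrite /from_subspace /=; case: ifP => // hx'.
  by rewrite FG //; apply/le_anti; rewrite hx hx'.
Qed.

End unit_interval.

Section continuity_helpers.
Context {R : realType} {X Y Z : topologicalType}.

Lemma contD (f g : X -> R) :
  continuous f -> continuous g -> continuous (fun x => f x + g x).
Proof. by move=> cf cg x; exact: cvgD (cf x) (cg x). Qed.

Lemma contB (f g : X -> R) :
  continuous f -> continuous g -> continuous (fun x => f x - g x).
Proof. by move=> cf cg x; exact: cvgB (cf x) (cg x). Qed.

Lemma contM (f g : X -> R) :
  continuous f -> continuous g -> continuous (fun x => f x * g x).
Proof. by move=> cf cg x; exact: cvgM (cf x) (cg x). Qed.

Lemma contmin (f g : X -> R) :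
  continuous f -> continuous g -> continuous (fun x => Num.min (f x) (g x)).
Proof. by move=> cf cg x; exact: (continuous_min (cf x) (cg x)). Qed.

Lemma contcomp (f : X -> Y) (g : Y -> Z) :
  continuous f -> continuous g -> continuous (fun x => g (f x)).
Proof. by move=> cf cg x; apply: continuous_comp; [exact: cf | exact: cg]. Qed.

Lemma contpair (f : X -> Y) (g : X -> Z) :
  continuous f -> continuous g -> continuous (fun x => (f x, g x)).
Proof. by move=> cf cg x; apply: cvg_pair; [exact: cf | exact: cg]. Qed.

Lemma contfst : continuous (@fst X Y).
Proof. by move=> x; exact: cvg_fst. Qed.

Lemma contsnd : continuous (@snd X Y).
Proof. by move=> x; exact: cvg_snd. Qed.

Lemma contcst (a : Y) : continuous (fun _ : X => a).
Proof. by move=> x; exact: cvg_cst. Qed.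

Lemma contid : continuous (fun x : X => x).
Proof. by move=> x; exact: cvg_id. Qed.

End continuity_helpers.

Section path_homotopy.
Context {R : realType} {T : topologicalType}.
Local Notation I := (itv01 R).
Implicit Types x y z : T.

(* Homotopy relative to the endpoints; the first coordinate of I * I is the
   homotopy parameter. *)
Definition path_homotopic x y (p q : {path I from x to y in T}) : Prop :=
  exists H : I * I -> T, continuous H /\
    [/\ forall t, H (zero, t) = p t, forall t, H (one, t) = q t,
        forall s, H (s, zero) = x & forall s, H (s, one) = y].

Section cat.
Context x y z (p : {path I from x to y in T}) (q : {path I from y to z in T}).

Definition path_cat_fun (t : I) : T :=
  if set_val t <= 1/2 :> R then p (clamp01 (2 * set_val t))
  else q (clamp01 (2 * set_val t - 1)).

Lemma path_cat_cont : continuous path_cat_fun.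
Proof.
have c2 : continuous (fun t : I => 2 * set_val t : R).
  by apply: contM; [exact: contcst | exact: cont_val01].
apply: pasting; first exact: cont_val01.
- apply: contcomp; last exact: cts_fun.
  by apply: contcomp; [exact: c2 | exact: cont_clamp01].
- apply: contcomp; last exact: cts_fun.
  apply: contcomp; last exact: cont_clamp01.
  by apply: contB; [exact: c2 | exact: contcst].
- move=> t ->.
  have -> : 2 * (1/2) = 1 :> R by lra.
  by rewrite subrr [LHS]path_one [RHS]path_zero.
Qed.

Lemma path_cat0 : path_cat_fun zero = x.
Proof.
rewrite /path_cat_fun val_zero01 ifT; last by lra.
by rewrite mulr0 path_zero.
Qed.

Lemma path_cat1 : path_cat_fun one = z.
Proof.
rewrite /path_cat_fun val_one01 ifF; last by apply/negbTE; lra.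
have -> : 2 * 1 - 1 = 1 :> R by lra.
by rewrite path_one.
Qed.

Definition path_cat : {path I from x to z in T} :=
  mk_path path_cat_cont path_cat0 path_cat1.

Lemma path_catE (r : R) : 0 <= r <= 1 -> path_cat (clamp01 r) =
  if r <= 1/2 then p (clamp01 (2 * r)) else q (clamp01 (2 * r - 1)).
Proof.
by move=> r01; rewrite [LHS]/(path_cat_fun _) /path_cat_fun val_clamp01.
Qed.

End cat.

Section rev.
Context x y (p : {path I from x to y in T}).

Definition path_rev_fun (t : I) : T := p (clamp01 (1 - set_val t)).

Lemma path_rev_cont : continuous path_rev_fun.
Proof.
apply: contcomp; last exact: cts_fun.
apply: contcomp; last exact: cont_clamp01.
by apply: contB; [exact: contcst | exact: cont_val01].
Qed.

Lemma path_rev0 : path_rev_fun zero = y.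
Proof. by rewrite /path_rev_fun val_zero01 subr0 path_one. Qed.

Lemma path_rev1 : path_rev_fun one = x.
Proof. by rewrite /path_rev_fun val_one01 subrr path_zero. Qed.

Definition path_rev : {path I from y to x in T} :=
  mk_path path_rev_cont path_rev0 path_rev1.

Lemma path_revE (r : R) : 0 <= r <= 1 ->
  path_rev (clamp01 r) = p (clamp01 (1 - r)).
Proof.
by move=> r01; rewrite [LHS]/(path_rev_fun _) /path_rev_fun val_clamp01.
Qed.

End rev.

Section cst.
Context (x : T).

Definition path_cst : {path I from x to x in T} :=
  mk_path (@contcst I T x) erefl erefl.

End cst.

Lemma path_homotopic_refl x y (p : {path I from x to y in T}) :
  path_homotopic p p.
Proof.
exists (fun u => p u.2); split.
  by apply: contcomp; [exact: contsnd | exact: cts_fun].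
by split=> // s; rewrite ?path_zero ?path_one.
Qed.

Lemma path_homotopic_sym x y (p q : {path I from x to y in T}) :
  path_homotopic p q -> path_homotopic q p.
Proof.
move=> [H [cH [H0 H1 Hx Hy]]].
exists (fun u => H (clamp01 (1 - set_val u.1), u.2)); split.
  apply: contcomp; last exact: cH.
  apply: contpair; last exact: contsnd.
  apply: contcomp; last exact: cont_clamp01.
  apply: contB; first exact: contcst.
  by apply: contcomp; [exact: contfst | exact: cont_val01].
split=> /= t.
- by rewrite val_zero01 subr0 H1.
- by rewrite val_one01 subrr H0.
- by rewrite Hx.
- by rewrite Hy.
Qed.

Lemma path_homotopic_trans x y (p q r : {path I from x to y in T}) :
  path_homotopic p q -> path_homotopic q r -> path_homotopic p r.
Proof.
move=> [H [cH [H0 H1 Hx Hy]]] [K [cK [K0 K1 Kx Ky]]].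
have c2 : continuous (fun u : I * I => 2 * set_val u.1 : R).
  apply: contM; first exact: contcst.
  by apply: contcomp; [exact: contfst | exact: cont_val01].
exists (fun u => if set_val u.1 <= 1/2 :> R
  then H (clamp01 (2 * set_val u.1), u.2)
  else K (clamp01 (2 * set_val u.1 - 1), u.2)); split.
  apply: pasting.
  - by apply: contcomp; [exact: contfst | exact: cont_val01].
  - apply: contcomp; last exact: cH.
    apply: contpair; last exact: contsnd.
    by apply: contcomp; [exact: c2 | exact: cont_clamp01].
  - apply: contcomp; last exact: cK.
    apply: contpair; last exact: contsnd.
    apply: contcomp; last exact: cont_clamp01.
    by apply: contB; [exact: c2 | exact: contcst].
  - move=> u ->; have -> : 2 * (1/2) = 1 :> R by lra.
    by rewrite subrr [LHS]H1 [RHS]K0.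
split=> /= t.
- by rewrite val_zero01 ifT ?mulr0 ?H0 //; lra.
- rewrite val_one01 ifF; last by apply/negbTE; lra.
  by have -> : 2 * 1 - 1 = 1 :> R by lra; rewrite K1.
- by case: ifP; rewrite ?Hx ?Kx.
- by case: ifP; rewrite ?Hy ?Ky.
Qed.

Lemma path_cat_homotopic x y z (p p' : {path I from x to y in T})
    (q q' : {path I from y to z in T}) :
  path_homotopic p p' -> path_homotopic q q' ->
  path_homotopic (path_cat p q) (path_cat p' q').
Proof.
move=> [H [cH [H0 H1 Hx Hy]]] [K [cK [K0 K1 Kx Ky]]].
have c2 : continuous (fun u : I * I => 2 * set_val u.2 : R).
  apply: contM; first exact: contcst.
  by apply: contcomp; [exact: contsnd | exact: cont_val01].
exists (fun u => if set_val u.2 <= 1/2 :> R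
  then H (u.1, clamp01 (2 * set_val u.2))
  else K (u.1, clamp01 (2 * set_val u.2 - 1))); split.
  apply: pasting.
  - by apply: contcomp; [exact: contsnd | exact: cont_val01].
  - apply: contcomp; last exact: cH.
    apply: contpair; first exact: contfst.
    by apply: contcomp; [exact: c2 | exact: cont_clamp01].
  - apply: contcomp; last exact: cK.
    apply: contpair; first exact: contfst.
    apply: contcomp; last exact: cont_clamp01.
    by apply: contB; [exact: c2 | exact: contcst].
  - move=> u ->; have -> : 2 * (1/2) = 1 :> R by lra.
    by rewrite subrr [LHS]Hy [RHS]Kx.
split=> /= t.
- by rewrite H0 K0.
- by rewrite H1 K1.
- by rewrite val_zero01 ifT ?mulr0 ?Hx //; lra.
- rewrite val_one01 ifF; last by apply/negbTE; lra.
  by have -> : 2 * 1 - 1 = 1 :> R by lra; rewrite Ky.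
Qed.

Lemma path_rev_homotopic x y (p p' : {path I from x to y in T}) :
  path_homotopic p p' -> path_homotopic (path_rev p) (path_rev p').
Proof.
move=> [H [cH [H0 H1 Hx Hy]]].
exists (fun u => H (u.1, clamp01 (1 - set_val u.2))); split.
  apply: contcomp; last exact: cH.
  apply: contpair; first exact: contfst.
  apply: contcomp; last exact: cont_clamp01.
  apply: contB; first exact: contcst.
  by apply: contcomp; [exact: contsnd | exact: cont_val01].
split=> /= t.
- by rewrite H0.
- by rewrite H1.
- by rewrite val_zero01 subr0 Hy.
- by rewrite val_one01 subrr Hx.
Qed.

(* Two reparametrizations of a path with the same endpoints are homotopic. *)
Lemma reparam_homotopic x y (p q : {path I from x to y in T}) (f : I -> T)
    (phi psi : I -> R) :
  continuous f -> continuous phi -> continuous psi ->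
  phi zero = psi zero -> phi one = psi one ->
  (forall t, p t = f (clamp01 (phi t))) ->
  (forall t, q t = f (clamp01 (psi t))) -> path_homotopic p q.
Proof.
move=> cf cphi cpsi e0 e1 pE qE.
exists (fun u => f (clamp01 ((1 - set_val u.1) * phi u.2
                             + set_val u.1 * psi u.2))); split.
  have c1 : continuous (fun u : I * I => set_val u.1 : R).
    by apply: contcomp; [exact: contfst | exact: cont_val01].
  apply: contcomp; last exact: cf.
  apply: contcomp; last exact: cont_clamp01.
  apply: contD; apply: contM.
  - by apply: contB; [exact: contcst | exact: c1].
  - by apply: contcomp; [exact: contsnd | exact: cphi].
  - exact: c1.
  - by apply: contcomp; [exact: contsnd | exact: cpsi].
split=> /= t.
- by rewrite val_zero01 subr0 mul1r mul0r addr0 -pE.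
- by rewrite val_one01 subrr mul1r mul0r add0r -qE.
- by rewrite e0 -mulrDl subrK mul1r -qE path_zero.
- by rewrite e1 -mulrDl subrK mul1r -qE path_one.
Qed.

Lemma path_catA x y z w (p : {path I from x to y in T})
    (q : {path I from y to z in T}) (r : {path I from z to w in T}) :
  path_homotopic (path_cat p (path_cat q r)) (path_cat (path_cat p q) r).
Proof.
apply: (@reparam_homotopic _ _ _ _ (path_cat p (path_cat q r))
  (fun t => set_val t)
  (fun t => Num.min (2 * set_val t)
              (Num.min (set_val t + 1/4) (set_val t * (1/2) + 1/2)))).
- exact: cts_fun.
- exact: cont_val01.
- apply: contmin; first by apply: contM; [exact: contcst | exact: cont_val01].
  apply: contmin; first by apply: contD; [exact: cont_val01 | exact: contcst].
  apply: contD; last exact: contcst.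
  by apply: contM; [exact: cont_val01 | exact: contcst].
- by rewrite val_zero01 mulr0 min_l // le_min; apply/andP; split; lra.
- rewrite val_one01 (@min_r _ _ (1 + 1/4)); last by lra.
  by rewrite min_r; lra.
- by move=> t; rewrite clamp01K.
move=> t; have /andP[t0 t1] := itv01P t.
rewrite -{1}[t]clamp01K; set a := set_val t in t0 t1 *.
have hC (b b' : R) : b = b' -> clamp01 b = clamp01 b' by move=> ->.
have [h4|h4] := leP a (1/4).
  rewrite (@min_l _ _ (2 * a)); last by rewrite le_min; apply/andP; split; lra.
  rewrite [LHS]path_catE; last by apply/andP; split; lra.
  rewrite [LHS]ifT; last by lra.
  rewrite [RHS]path_catE; last by apply/andP; split; lra.
  rewrite [RHS]ifT; last by lra.
  rewrite path_catE; last by apply/andP; split; lra.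
  by rewrite ifT //; lra.
have [h2|h2] := leP a (1/2).
  rewrite (@min_l _ _ (a + 1/4)); last by lra.
  rewrite min_r; last by lra.
  rewrite [LHS]path_catE; last by apply/andP; split; lra.
  rewrite [LHS]ifT; last by lra.
  rewrite [RHS]path_catE; last by apply/andP; split; lra.
  rewrite [RHS]ifF; last by apply/negbTE; lra.
  rewrite [LHS]path_catE; last by apply/andP; split; lra.
  rewrite [LHS]ifF; last by apply/negbTE; lra.
  rewrite [RHS]path_catE; last by apply/andP; split; lra.
  rewrite [RHS]ifT; last by lra.
  by congr (q _); apply: hC; lra.
rewrite (@min_r _ _ (a + 1/4)); last by lra.
rewrite min_r; last by lra.
rewrite [LHS]path_catE; last by apply/andP; split; lra.
rewrite [LHS]ifF; last by apply/negbTE; lra.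
rewrite [RHS]path_catE; last by apply/andP; split; lra.
rewrite [RHS]ifF; last by apply/negbTE; lra.
rewrite [RHS]path_catE; last by apply/andP; split; lra.
rewrite [RHS]ifF; last by apply/negbTE; lra.
by congr (r _); apply: hC; lra.
Qed.

Lemma path_cat_cstl x y (p : {path I from x to y in T}) :
  path_homotopic (path_cat (path_cst x) p) p.
Proof.
apply: path_homotopic_sym.
apply: (@reparam_homotopic _ _ _ _ p (fun t => set_val t)
  (fun t => 2 * set_val t - Num.min 1 (2 * set_val t))).
- exact: cts_fun.
- exact: cont_val01.
- have c2 : continuous (fun t : I => 2 * set_val t : R).
    by apply: contM; [exact: contcst | exact: cont_val01].
  by apply: contB => //; apply: contmin => //; exact: contcst.
- by rewrite val_zero01 mulr0 min_r ?subr0 // ler01.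
- by rewrite val_one01 min_l; lra.
- by move=> t; rewrite clamp01K.
move=> t; have a01 := itv01P t.
rewrite -{1}[t]clamp01K; set a := set_val t in a01 *.
rewrite path_catE //; case: ifPn => h.
  by rewrite min_r ?subrr ?path_zero //; lra.
by rewrite min_l //; lra.
Qed.

Lemma path_cat_cstr x y (p : {path I from x to y in T}) :
  path_homotopic (path_cat p (path_cst y)) p.
Proof.
apply: path_homotopic_sym.
apply: (@reparam_homotopic _ _ _ _ p (fun t => set_val t)
  (fun t => Num.min 1 (2 * set_val t))).
- exact: cts_fun.
- exact: cont_val01.
- apply: contmin; first exact: contcst.
  by apply: contM; [exact: contcst | exact: cont_val01].
- by rewrite val_zero01 mulr0 min_r // ler01.
- by rewrite val_one01 min_l; lra.
- by move=> t; rewrite clamp01K.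
move=> t; have a01 := itv01P t.
rewrite -{1}[t]clamp01K; set a := set_val t in a01 *.
rewrite path_catE //; case: ifPn => h.
  by rewrite min_r //; lra.
by rewrite min_l ?path_one //; lra.
Qed.

Lemma path_cat_revr x y (p : {path I from x to y in T}) :
  path_homotopic (path_cat p (path_rev p)) (path_cst x).
Proof.
apply: (@reparam_homotopic _ _ _ _ p
  (fun t => Num.min (2 * set_val t) (2 - 2 * set_val t)) (fun=> 0)).
- exact: cts_fun.
- have c2 : continuous (fun t : I => 2 * set_val t : R).
    by apply: contM; [exact: contcst | exact: cont_val01].
  by apply: contmin => //; apply: contB => //; exact: contcst.
- exact: contcst.
- by rewrite val_zero01 mulr0 min_l; lra.
- by rewrite val_one01 min_r; lra.
- move=> t; have a01 := itv01P t.
  rewrite -{1}[t]clamp01K; set a := set_val t in a01 *.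
  rewrite path_catE //; case: ifPn => h; first by rewrite min_l //; lra.
  rewrite path_revE; last by lra.
  rewrite min_r; last by lra.
  by congr (p (clamp01 _)); lra.
- by move=> t; rewrite path_zero.
Qed.

Lemma path_cat_revl x y (p : {path I from x to y in T}) :
  path_homotopic (path_cat (path_rev p) p) (path_cst y).
Proof.
apply: (@reparam_homotopic _ _ _ _ (path_rev p)
  (fun t => Num.min (2 * set_val t) (2 - 2 * set_val t)) (fun=> 0)).
- exact: cts_fun.
- have c2 : continuous (fun t : I => 2 * set_val t : R).
    by apply: contM; [exact: contcst | exact: cont_val01].
  by apply: contmin => //; apply: contB => //; exact: contcst.
- exact: contcst.
- by rewrite val_zero01 mulr0 min_l; lra.
- by rewrite val_one01 min_r; lra.
- move=> t; have a01 := itv01P t.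
  rewrite -{1}[t]clamp01K; set a := set_val t in a01 *.
  rewrite path_catE //; case: ifPn => h; first by rewrite min_l //; lra.
  rewrite min_r; last by lra.
  rewrite path_revE; last by lra.
  by congr (p (clamp01 _)); lra.
- by move=> t; rewrite path_zero.
Qed.

End path_homotopy.

Section fundamental_group.
Context (R : realType) (T : topologicalType) (x : T).
Local Notation I := (itv01 R).
Local Notation loop := {path I from x to x in T}.

Definition loop_rel (p q : loop) : bool := `[< path_homotopic p q >].

Lemma loop_rel_refl : reflexive loop_rel.
Proof. by move=> p; apply/asboolP; exact: path_homotopic_refl. Qed.

Lemma loop_rel_sym : symmetric loop_rel.
Proof. by move=> p q; apply/asboolP/asboolP; exact: path_homotopic_sym. Qed.

Lemma loop_rel_trans : transitive loop_rel.
Proof.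
move=> q p r /asboolP pq /asboolP qr; apply/asboolP.
exact: path_homotopic_trans pq qr.
Qed.

Canonical loop_equiv := EquivRel loop_rel loop_rel_refl loop_rel_sym loop_rel_trans.

Definition pi1 : Type := {eq_quot loop_equiv}.
HB.instance Definition _ := Choice.on pi1.
HB.instance Definition _ := EqQuotient.on pi1.

Definition pi1_class (p : loop) : pi1 := \pi_pi1 p.

Lemma pi1_classP (p q : loop) : pi1_class p = pi1_class q <-> path_homotopic p q.
Proof.
split; first by move=> /eqmodP /asboolP.
by move=> pq; apply/eqmodP/asboolP.
Qed.

Lemma pi1_repr (p : loop) : path_homotopic (repr (pi1_class p)) p.
Proof. by apply/pi1_classP; rewrite /pi1_class reprK. Qed.

Lemma pi1_reprK (a : pi1) : pi1_class (repr a) = a.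
Proof. exact: reprK. Qed.

Definition pi1_mul (a b : pi1) := pi1_class (path_cat (repr a) (repr b)).
Definition pi1_one := pi1_class (path_cst x).
Definition pi1_inv (a : pi1) := pi1_class (path_rev (repr a)).

Lemma pi1_mul_class (p q : loop) :
  pi1_mul (pi1_class p) (pi1_class q) = pi1_class (path_cat p q).
Proof. by apply/pi1_classP/path_cat_homotopic; exact: pi1_repr. Qed.

Lemma pi1_inv_class (p : loop) : pi1_inv (pi1_class p) = pi1_class (path_rev p).
Proof. by apply/pi1_classP/path_rev_homotopic; exact: pi1_repr. Qed.

Lemma pi1_mulA : associative pi1_mul.
Proof.
move=> a b c; rewrite -(pi1_reprK a) -(pi1_reprK b) -(pi1_reprK c).
by rewrite !pi1_mul_class; apply/pi1_classP/path_catA.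
Qed.

Lemma pi1_mul1g : left_id pi1_one pi1_mul.
Proof.
by move=> a; rewrite -(pi1_reprK a) pi1_mul_class; apply/pi1_classP/path_cat_cstl.
Qed.

Lemma pi1_mulg1 : right_id pi1_one pi1_mul.
Proof.
by move=> a; rewrite -(pi1_reprK a) pi1_mul_class; apply/pi1_classP/path_cat_cstr.
Qed.

Lemma pi1_mulVg : left_inverse pi1_one pi1_inv pi1_mul.
Proof.
move=> a; rewrite -(pi1_reprK a) pi1_inv_class pi1_mul_class.
exact/pi1_classP/path_cat_revl.
Qed.

Lemma pi1_mulgV : right_inverse pi1_one pi1_inv pi1_mul.
Proof.
move=> a; rewrite -(pi1_reprK a) pi1_inv_class pi1_mul_class.
exact/pi1_classP/path_cat_revr.
Qed.

HB.instance Definition _ := isGroup.Build pi1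
  pi1_mulA pi1_mul1g pi1_mulg1 pi1_mulVg pi1_mulgV.

End fundamental_group.

Section pi1_functoriality.
Context {R : realType} {T U : topologicalType} (f : T -> U) (x : T) (y : U).
Context (cf : continuous f) (fx : f x = y).
Local Notation I := (itv01 R).

Section loop_map.
Context (p : {path I from x to x in T}).

Lemma loop_map_cont : continuous (fun t : I => f (p t)).
Proof. by apply: contcomp; [exact: cts_fun | exact: cf]. Qed.

Lemma loop_map0 : f (p zero) = y. Proof. by rewrite path_zero. Qed.

Lemma loop_map1 : f (p one) = y. Proof. by rewrite path_one. Qed.

Definition loop_map : {path I from y to y in U} :=
  mk_path loop_map_cont loop_map0 loop_map1.

End loop_map.

Definition pi1_map (a : pi1 R x) : pi1 R y := pi1_class (loop_map (repr a)).

Lemma loop_map_homotopic (p q : {path I from x to x in T}) :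
  path_homotopic p q -> path_homotopic (loop_map p) (loop_map q).
Proof.
move=> [H [cH [H0 H1 Hx Hy]]]; exists (fun u => f (H u)); split.
  by apply: contcomp; [exact: cH | exact: cf].
by split=> t; rewrite ?H0 ?H1 ?Hx ?Hy.
Qed.

Lemma pi1_map_class (p : {path I from x to x in T}) :
  pi1_map (pi1_class p) = pi1_class (loop_map p).
Proof. by apply/pi1_classP/loop_map_homotopic; exact: pi1_repr. Qed.

Lemma pi1_mapM (a b : pi1 R x) : pi1_map (a * b)%g = (pi1_map a * pi1_map b)%g.
Proof.
rewrite -(pi1_reprK a) -(pi1_reprK b).
have -> : forall p q : {path I from x to x in T},
  (pi1_class p * pi1_class q)%g = pi1_class (path_cat p q) by exact: pi1_mul_class.
rewrite !pi1_map_class [RHS]pi1_mul_class; congr pi1_class.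
by apply/path_eqP => t /=; rewrite /mk_path /= /path_cat_fun /=; case: ifP.
Qed.

End pi1_functoriality.

Section planar.
Context {R : realType}.
Local Notation I := (itv01 R).

Definition unit_disk : set (R * R) := [set w | w.1 ^+ 2 + w.2 ^+ 2 <= 1].

Definition unit_circle (t : I) : R * R :=
  (cos (2 * pi * set_val t), sin (2 * pi * set_val t)).

(* c is a closed curve in the punctured plane that is freely homotopic there to
   the counterclockwise unit circle, i.e. its winding number about 0 is 1. *)
Definition winds_once (c : I -> R * R) : Prop :=
  exists H : I * I -> R * R, continuous H /\
    [/\ forall t, H (zero, t) = c t, forall t, H (one, t) = unit_circle t,
        forall s, H (s, zero) = H (s, one) & forall u, H u <> (0, 0)].

End planar.

Section orientation.
Context {R : realType} {T : topologicalType} (B : set T).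
Local Notation I := (itv01 R).

(* A chart is a pair of a domain and a map to the plane; the values of the map
   outside the domain are irrelevant. *)
Definition planar_chart : Type := (set T * (T -> R * R))%type.

Definition is_chart (c : planar_chart) : Prop :=
  [/\ open c.1, c.1 `<=` ~` B,
      forall z, c.1 z -> {for z, continuous c.2},
      forall z w, c.1 z -> c.1 w -> c.2 z = c.2 w -> z = w &
      forall W, open W -> W `<=` c.1 -> open (c.2 @` W)].

(* The transition map b.2 \o a.2^-1 preserves the orientation of the plane: at
   each point z of the overlap, it sends a small counterclockwise circle around
   a.2 z (bounding a disk inside its domain) to a curve that winds once around
   b.2 z. Here gam is a local inverse of a.2, rescaled to the unit disk. *)
Definition coherent (a b : planar_chart) : Prop :=
  forall z, a.1 z -> b.1 z ->
  exists2 r : R, 0 < r & exists2 gam : R * R -> T,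
    forall w, unit_disk w -> [/\ a.1 (gam w), b.1 (gam w) &
      a.2 (gam w) = ((a.2 z).1 + r * w.1, (a.2 z).2 + r * w.2)] &
    winds_once (fun t : I => b.2 (gam (unit_circle t)) - b.2 z).

(* Orientations of a surface T with boundary B, as maximal oriented atlases of
   the interior. *)
Definition orientation (O : set planar_chart) : Prop :=
  [/\ forall c, O c -> is_chart c,
      forall z, ~ B z -> exists2 c, O c & c.1 z,
      forall a b, O a -> O b -> coherent a b &
      forall c, is_chart c ->
        (forall a, O a -> coherent a c /\ coherent c a) -> O c].

End orientation.

Arguments planar_chart : clear implicits.

Section mapping_class_group.
Context {R : realType} {T : topologicalType}.
Context (B : set T) (O : set (planar_chart R T)).
Local Notation I := (itv01 R).

(* Homeomorphisms of T that fix B pointwise and preserve the orientation O,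
   meaning that the pull-back of the atlas O is O. *)
Record homeo := Homeo {
  hfun :> T -> T;
  hinv : T -> T;
  hfun_cont : continuous hfun;
  hinv_cont : continuous hinv;
  hfunK : cancel hfun hinv;
  hinvK : cancel hinv hfun;
  hfun_fix : forall b, B b -> hfun b = b;
  hfun_orient : forall U phi, O (hfun @^-1` U, phi \o hfun) <-> O (U, phi) }.

HB.instance Definition _ := gen_eqMixin homeo.
HB.instance Definition _ := gen_choiceMixin homeo.

Lemma homeo_eq (h k : homeo) : h =1 k -> h = k.
Proof.
move=> hk; have hki : hinv h = hinv k.
  by apply/funext => x; apply: (can_inj (hfunK k)); rewrite hinvK -hk hinvK.
case: h k hk hki => [h h' ? ? ? ? ? ?] [k k' ? ? ? ? ? ?] /= /funext hk hki.
by subst k k'; congr Homeo; exact: Prop_irrelevance.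
Qed.

Definition homeo_id : homeo :=
  @Homeo id id contid contid (fun=> erefl) (fun=> erefl) (fun _ _ => erefl)
    (fun _ _ => iff_refl _).

Section comp.
Context (h k : homeo).

Lemma homeo_comp_cont : continuous (h \o k).
Proof. exact: contcomp (@hfun_cont k) (@hfun_cont h). Qed.

Lemma homeo_comp_inv_cont : continuous (hinv k \o hinv h).
Proof. exact: contcomp (@hinv_cont h) (@hinv_cont k). Qed.

Lemma homeo_compK : cancel (h \o k) (hinv k \o hinv h).
Proof. exact: can_comp (@hfunK h) (@hfunK k). Qed.

Lemma homeo_comp_invK : cancel (hinv k \o hinv h) (h \o k).
Proof. exact: can_comp (@hinvK k) (@hinvK h). Qed.

Lemma homeo_comp_fix b : B b -> (h \o k) b = b.
Proof. by move=> Bb; rewrite /= !hfun_fix. Qed.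

Lemma homeo_comp_orient U phi :
  O ((h \o k) @^-1` U, phi \o (h \o k)) <-> O (U, phi).
Proof.
have := hfun_orient k (h @^-1` U) (phi \o h).
have := hfun_orient h U phi.
by rewrite -comp_preimage => -> ->.
Qed.

Definition homeo_comp : homeo := Homeo homeo_comp_cont homeo_comp_inv_cont
  homeo_compK homeo_comp_invK homeo_comp_fix homeo_comp_orient.

End comp.

Section inv.
Context (h : homeo).

Lemma homeo_inv_fix b : B b -> hinv h b = b.
Proof. by move=> Bb; rewrite -{1}(hfun_fix h Bb) hfunK. Qed.

Lemma homeo_inv_orient U phi :
  O (hinv h @^-1` U, phi \o hinv h) <-> O (U, phi).
Proof.
rewrite -(hfun_orient h (hinv h @^-1` U)).
have -> : h @^-1` (hinv h @^-1` U) = U.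
  by apply/seteqP; split=> x; rewrite /preimage /= hfunK.
by have -> : (phi \o hinv h) \o h = phi by apply/funext => x /=; rewrite hfunK.
Qed.

Definition homeo_inv : homeo := Homeo (@hinv_cont h) (@hfun_cont h)
  (@hinvK h) (@hfunK h) homeo_inv_fix homeo_inv_orient.

End inv.

(* Isotopy through homeomorphisms of the same kind; asking for continuity of the
   inverses too makes it a level-preserving homeomorphism of I * T. *)
Definition isotopic (h k : homeo) : Prop :=
  exists F : I -> homeo,
    [/\ continuous (fun u : I * T => F u.1 u.2),
        continuous (fun u : I * T => hinv (F u.1) u.2),
        F zero = h & F one = k].

Lemma isotopic_refl h : isotopic h h.
Proof.
exists (fun=> h); split=> //=.
- by apply: contcomp; [exact: contsnd | exact: hfun_cont].
- by apply: contcomp; [exact: contsnd | exact: hinv_cont].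
Qed.

Lemma isotopic_sym h k : isotopic h k -> isotopic k h.
Proof.
move=> [F [cF cF' F0 F1]].
have c : continuous (fun u : I * T => (clamp01 (1 - set_val u.1 : R), u.2)).
  apply: contpair; last exact: contsnd.
  apply: contcomp; last exact: cont_clamp01.
  apply: contB; first exact: contcst.
  by apply: contcomp; [exact: contfst | exact: cont_val01].
exists (fun s => F (clamp01 (1 - set_val s))); split.
- exact: contcomp c cF.
- exact: contcomp c cF'.
- by rewrite val_zero01 subr0.
- by rewrite val_one01 subrr.
Qed.

Lemma isotopic_trans h k l : isotopic h k -> isotopic k l -> isotopic h l.
Proof.
move=> [F [cF cF' F0 F1]] [G [cG cG' G0 G1]].
have c2 : continuous (fun u : I * T => 2 * set_val u.1 : R).
  apply: contM; first exact: contcst.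
  by apply: contcomp; [exact: contfst | exact: cont_val01].
have cl : continuous (fun u : I * T => (clamp01 (2 * set_val u.1 : R), u.2)).
  apply: contpair; last exact: contsnd.
  by apply: contcomp; [exact: c2 | exact: cont_clamp01].
have cr : continuous (fun u : I * T => (clamp01 (2 * set_val u.1 - 1 : R), u.2)).
  apply: contpair; last exact: contsnd.
  apply: contcomp; last exact: cont_clamp01.
  by apply: contB; [exact: c2 | exact: contcst].
have cv : continuous (fun u : I * T => set_val u.1 : R).
  by apply: contcomp; [exact: contfst | exact: cont_val01].
have mid (x : T) (s : I) : set_val s = 1/2 :> R ->
    F (clamp01 (2 * set_val s)) = G (clamp01 (2 * set_val s - 1)).
  move=> ->; have -> : 2 * (1/2) = 1 :> R by lra.
  by rewrite subrr [LHS]F1 [RHS]G0.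
exists (fun s => if set_val s <= 1/2 :> R then F (clamp01 (2 * set_val s))
  else G (clamp01 (2 * set_val s - 1))); split.
- under eq_fun do rewrite (fun_if (fun h : homeo => hfun h _)).
  apply: pasting => //; [exact: contcomp cl cF | exact: contcomp cr cG |].
  by move=> u /(mid u.2) ->.
- under eq_fun do rewrite (fun_if (fun h : homeo => hinv h _)).
  apply: pasting => //; [exact: contcomp cl cF' | exact: contcomp cr cG' |].
  by move=> u /(mid u.2) ->.
- by rewrite val_zero01 ifT ?mulr0 //; lra.
- rewrite val_one01 ifF; last by apply/negbTE; lra.
  by have -> : 2 * 1 - 1 = 1 :> R by lra.
Qed.

Lemma isotopic_comp h h' k k' :
  isotopic h h' -> isotopic k k' ->
  isotopic (homeo_comp h k) (homeo_comp h' k').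
Proof.
move=> [F [cF cF' F0 F1]] [G [cG cG' G0 G1]].
exists (fun s => homeo_comp (F s) (G s)); split; rewrite ?F0 ?F1 ?G0 ?G1 //.
- exact: contcomp (contpair contfst cG) cF.
- exact: contcomp (contpair contfst cF') cG'.
Qed.

Lemma isotopic_inv h h' :
  isotopic h h' -> isotopic (homeo_inv h) (homeo_inv h').
Proof.
move=> [F [cF cF' F0 F1]].
by exists (fun s => homeo_inv (F s)); split; rewrite ?F0 ?F1.
Qed.

Definition isotopic_rel (h k : homeo) : bool := `[< isotopic h k >].

Lemma isotopic_rel_refl : reflexive isotopic_rel.
Proof. by move=> h; apply/asboolP; exact: isotopic_refl. Qed.

Lemma isotopic_rel_sym : symmetric isotopic_rel.
Proof. by move=> h k; apply/asboolP/asboolP; exact: isotopic_sym. Qed.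

Lemma isotopic_rel_trans : transitive isotopic_rel.
Proof.
move=> k h l /asboolP hk /asboolP kl; apply/asboolP.
exact: isotopic_trans hk kl.
Qed.

Canonical isotopic_equiv :=
  EquivRel isotopic_rel isotopic_rel_refl isotopic_rel_sym isotopic_rel_trans.

Definition mcg : Type := {eq_quot isotopic_equiv}.
HB.instance Definition _ := Choice.on mcg.
HB.instance Definition _ := EqQuotient.on mcg.

Definition mcg_class (h : homeo) : mcg := \pi_mcg h.

Lemma mcg_classP h k : mcg_class h = mcg_class k <-> isotopic h k.
Proof.
split; first by move=> /eqmodP /asboolP.
by move=> hk; apply/eqmodP/asboolP.
Qed.

Lemma mcg_repr h : isotopic (repr (mcg_class h)) h.
Proof. by apply/mcg_classP; rewrite /mcg_class reprK. Qed.

Lemma mcg_reprK (m : mcg) : mcg_class (repr m) = m.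
Proof. exact: reprK. Qed.

Definition mcg_mul (m n : mcg) : mcg := mcg_class (homeo_comp (repr m) (repr n)).
Definition mcg_one : mcg := mcg_class homeo_id.
Definition mcg_inv (m : mcg) : mcg := mcg_class (homeo_inv (repr m)).

Lemma mcg_mul_class h k :
  mcg_mul (mcg_class h) (mcg_class k) = mcg_class (homeo_comp h k).
Proof. by apply/mcg_classP/isotopic_comp; exact: mcg_repr. Qed.

Lemma mcg_inv_class h : mcg_inv (mcg_class h) = mcg_class (homeo_inv h).
Proof. by apply/mcg_classP/isotopic_inv; exact: mcg_repr. Qed.

Lemma mcg_mulA : associative mcg_mul.
Proof.
move=> a b c; rewrite -(mcg_reprK a) -(mcg_reprK b) -(mcg_reprK c).
by rewrite !mcg_mul_class; congr mcg_class; exact: homeo_eq.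
Qed.

Lemma mcg_mul1g : left_id mcg_one mcg_mul.
Proof.
move=> a; rewrite -(mcg_reprK a) mcg_mul_class; congr mcg_class.
exact: homeo_eq.
Qed.

Lemma mcg_mulg1 : right_id mcg_one mcg_mul.
Proof.
move=> a; rewrite -(mcg_reprK a) mcg_mul_class; congr mcg_class.
exact: homeo_eq.
Qed.

Lemma mcg_mulVg : left_inverse mcg_one mcg_inv mcg_mul.
Proof.
move=> a; rewrite -(mcg_reprK a) mcg_inv_class mcg_mul_class.
by congr mcg_class; apply: homeo_eq => x /=; rewrite hfunK.
Qed.

Lemma mcg_mulgV : right_inverse mcg_one mcg_inv mcg_mul.
Proof.
move=> a; rewrite -(mcg_reprK a) mcg_inv_class mcg_mul_class.
by congr mcg_class; apply: homeo_eq => x /=; rewrite hinvK.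
Qed.

HB.instance Definition _ := isGroup.Build mcg
  mcg_mulA mcg_mul1g mcg_mulg1 mcg_mulVg mcg_mulgV.

Section action.
Context (b : T) (Bb : B b).

Definition homeo_act (h : homeo) (a : pi1 R b) : pi1 R b :=
  pi1_map (@hfun_cont h) (hfun_fix h Bb) a.

Definition mcg_act (m : mcg) (a : pi1 R b) : pi1 R b := homeo_act (repr m) a.

Lemma homeo_act_isotopic h k a : isotopic h k -> homeo_act h a = homeo_act k a.
Proof.
move=> [F [cF _ F0 F1]]; apply/pi1_classP.
exists (fun u => F u.1 (repr a u.2)); split.
  apply: (@contcomp _ _ _ (fun u : I * I => (u.1, repr a u.2))
    (fun u : I * T => F u.1 u.2)) => //.
  apply: contpair; first exact: contfst.
  by apply: contcomp; [exact: contsnd | exact: cts_fun].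
split=> t /=; rewrite ?F0 ?F1 //.
- by rewrite path_zero; exact: hfun_fix.
- by rewrite path_one; exact: hfun_fix.
Qed.

Lemma mcg_act_class h a : mcg_act (mcg_class h) a = homeo_act h a.
Proof. exact/homeo_act_isotopic/mcg_repr. Qed.

Lemma mcg_act1 a : mcg_act 1%g a = a.
Proof.
rewrite -[1%g]/(mcg_class homeo_id) mcg_act_class -{2}(pi1_reprK a).
by congr pi1_class; apply/path_eqP.
Qed.

Lemma mcg_actM m n a : mcg_act (m * n)%g a = mcg_act m (mcg_act n a).
Proof.
rewrite -(mcg_reprK m) -(mcg_reprK n) -(pi1_reprK a).
rewrite -[(_ * _)%g]/(mcg_mul _ _) mcg_mul_class !mcg_act_class.
rewrite /homeo_act !pi1_map_class; congr pi1_class.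
by apply/path_eqP.
Qed.

Lemma mcg_act_mul m a c : mcg_act m (a * c)%g = (mcg_act m a * mcg_act m c)%g.
Proof. exact: pi1_mapM. Qed.

End action.

End mapping_class_group.

Section lower_central_series.
Context {K : groupType}.
Implicit Types S H : set K.
Local Open Scope group_scope.

Definition subgroup H : Prop := H 1 /\ forall x y, H x -> H y -> H (x * y^-1).

(* The convention opposite to that of [~ x, y]. *)
Definition comm (a b : K) : K := a * b * a^-1 * b^-1.

Definition comm_subgroup S H : set K :=
  smallest subgroup [set comm s t | s in S & t in H].

Definition prod_set S H : set K := [set s * t | s in S & t in H].

(* lcs S n is the (n+1)-st term of the lower central series of S. *)
Fixpoint lcs S (n : nat) : set K :=
  if n is n'.+1 then comm_subgroup S (lcs S n') else S.

Section double.
Context (X Y : set K).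

Fixpoint double_lcs (m : nat) : nat -> set K :=
  match m with
  | 0 => fun n => if n is n'.+1 then lcs Y n' else setT
  | m'.+1 => fix double_lcs_m n :=
      match n with
      | 0 => lcs X m'
      | n'.+1 => prod_set (comm_subgroup X (double_lcs m' n))
                          (comm_subgroup Y (double_lcs_m n'))
      end
  end.

Definition double_lcsz (m n : int) : set K :=
  double_lcs `|Num.max 0%R m|%N `|Num.max 0%R n|%N.

Lemma double_lcs00 : double_lcs 0 0 = setT. Proof. by []. Qed.

Lemma double_lcsS0 m : double_lcs m.+1 0 = lcs X m. Proof. by []. Qed.

Lemma double_lcs0S n : double_lcs 0 n.+1 = lcs Y n. Proof. by []. Qed.

Lemma double_lcsSS m n : double_lcs m.+1 n.+1 =
  prod_set (comm_subgroup (double_lcs 1 0) (double_lcs m n.+1))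
           (comm_subgroup (double_lcs 0 1) (double_lcs m.+1 n)).
Proof. by []. Qed.

End double.
End lower_central_series.

Section filtrations.
Context {M K : groupType} (act : M -> K -> K) (X Y : set K).

Definition act_comm (h : M) (k : K) : K := (act h k * k^-1)%g.

Definition act_comm_sub (h : M) (S H : set K) : Prop :=
  forall s, S s -> H (act_comm h s).

Definition goeritz : set M := [set h | act h @` X = X /\ act h @` Y = Y].

Definition goeritz_filtration (m n : nat) : set M :=
  [set h | goeritz h /\ forall i j : nat,
    act_comm_sub h (double_lcs X Y i j) (double_lcs X Y (m + i) (n + j))].

Definition int_filtration (m n : int) : set M :=
  [set h | forall i j : nat,
    act_comm_sub h (double_lcs X Y i j) (double_lcsz X Y (m + i%:Z) (n + j%:Z))
    /\ act_comm_sub h^-1%g (double_lcs X Y i j)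
         (double_lcsz X Y (m + i%:Z) (n + j%:Z))].

End filtrations.

Section subset_inclusion.
Context {S : topologicalType} (A C : set S) (AC : A `<=` C).

Definition subset_map (z : set_type A) : set_type C :=
  SigSub (mem_set (AC (set_valP z))).

Lemma subset_map_cont : continuous subset_map.
Proof. by apply: continuous_comp_initial; exact: initial_continuous. Qed.

End subset_inclusion.

Section heegaard_splitting.
Context (R : realType).

Definition S3 : topologicalType := one_point_compactification (R * R * R)%type.

(* The box [0, 2g+1] x [0, 3] x [0, 1] with g vertical square holes drilled
   through it. *)
Definition handlebody (g : nat) : set S3 := Some @`
  [set p : R * R * R | [/\ 0 <= p.1.1 <= g.*2.+1%:R, 0 <= p.1.2 <= 3,
    0 <= p.2 <= 1 & forall i : nat, (i < g)%N ->
      ~ (i.*2.+1%:R < p.1.1 < i.*2.+2%:R /\ 1 < p.1.2 < 2)]].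

Definition outer_handlebody (g : nat) : set S3 := closure (~` handlebody g).

(* The common boundary of the two handlebodies. *)
Definition splitting_surface (g : nat) : set S3 :=
  handlebody g `&` outer_handlebody g.

Definition is_disk (D : set S3) : Prop :=
  exists delta : R * R -> S3,
    [/\ {within unit_disk, continuous delta},
        forall v w, unit_disk v -> unit_disk w -> delta v = delta w -> v = w &
        delta @` unit_disk = D].

Section bounded_surface.
Context (g : nat) (D : set S3).

Definition surface_set : set S3 :=
  splitting_surface g `&` closure (splitting_surface g `\` D).

Definition surface : topologicalType := set_type surface_set.

Definition surface_boundary : set surface := [set z | D (set_val z)].

Lemma surface_sub_inner : surface_set `<=` handlebody g.
Proof. by move=> z [[]]. Qed.

Lemma surface_sub_outer : surface_set `<=` outer_handlebody g.
Proof. by move=> z [[]]. Qed.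

Definition Xbar (pt : surface) : set (pi1 R pt) :=
  [set a | pi1_map (y := subset_map surface_sub_inner pt)
             (@subset_map_cont _ _ _ surface_sub_inner) erefl a = 1%g].

Definition Ybar (pt : surface) : set (pi1 R pt) :=
  [set a | pi1_map (y := subset_map surface_sub_outer pt)
             (@subset_map_cont _ _ _ surface_sub_outer) erefl a = 1%g].

End bounded_surface.
End heegaard_splitting.

Arguments surface {R}.
Arguments surface_boundary {R}.
Arguments Xbar {R g D}.
Arguments Ybar {R g D}.

(* Main.v *)
Require Import Defs.
From mathcomp Require Import all_boot all_order all_algebra.
From mathcomp Require Import all_classical all_reals all_analysis.

(* The topology enters only through the facts that X and Y are kernels of
   homomorphisms, hence normal in K, and that the mapping class group acts on K
   by automorphisms.  An endomorphism mapping X into X and Y into Y maps each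
   K_{i,j} into itself; applied to conjugations, this shows that the K_{i,j} are
   normal subgroups.  As K_{m+1,n} lies in X and K_{m,n+1} lies in Y, an element
   of M_{m,n} with m, n >= 0 preserves X and Y.  Conversely, for h in G_{m,n},
   the condition on h^-1 follows from [h^-1, k] = h^-1([h, k]^-1). *)

Set Implicit Arguments.
Unset Strict Implicit.
Unset Printing Implicit Defensive.

Local Open Scope classical_set_scope.
Local Open Scope ring_scope.

Section double_lower_central_series.
Context {K : groupType}.
Local Open Scope group_scope.
Implicit Types (S H : set K) (f : K -> K).

(** * Homomorphisms and normal subgroups *)

Lemma morph_one (L : groupType) (f : K -> L) :
  {morph f : x y / x * y} -> f 1 = 1.
Proof. by move=> fM; apply: (mulgI (f 1)); rewrite -fM !mulg1. Qed.

Lemma morph_inv (L : groupType) (f : K -> L) :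
  {morph f : x y / x * y} -> {morph f : x / x^-1}.
Proof.
by move=> fM x; apply: (mulgI (f x)); rewrite -fM !mulgV (morph_one fM).
Qed.

Definition normal_subgroup H : Prop :=
  subgroup H /\ forall k x, H x -> H (k * x * k^-1).

Lemma kernel_normal (L : groupType) (f : K -> L) :
  {morph f : x y / x * y} -> normal_subgroup [set x | f x = 1].
Proof.
move=> fM; have fV := morph_inv fM; split; first split=> /=.
- exact: morph_one.
- by move=> x y fx fy; rewrite fM fV fx fy mulgV.
- by move=> k x /= fx; rewrite !fM fV fx mulg1 mulgV.
Qed.

Lemma subgroup1 H : subgroup H -> H 1.
Proof. by case. Qed.

Lemma subgroupV H x : subgroup H -> H x -> H x^-1.
Proof. by move=> [H1 HB] Hx; rewrite -[x^-1]mul1g; exact: HB. Qed.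

Lemma subgroupM H x y : subgroup H -> H x -> H y -> H (x * y).
Proof.
by move=> sH Hx Hy; rewrite -[y]invgK; apply: sH.2 => //; exact: subgroupV.
Qed.

(** * Commutator subgroups and products of subgroups *)

Lemma comm_subgroup_subgroup S H : subgroup (comm_subgroup S H).
Proof.
split=> [A [[A1 _] _] //|x y Cx Cy A AP].
exact: AP.1.2 (Cx A AP) (Cy A AP).
Qed.

Lemma comm_subgroup_sub S H A : subgroup A ->
  (forall s t, S s -> H t -> A (comm s t)) -> comm_subgroup S H `<=` A.
Proof.
move=> sA SHA; apply: smallest_sub => // _ [s Ss [t Ht <-]]; exact: SHA.
Qed.

(** The commutator is [s] times the conjugate of [s^-1] by [t], and normality puts both in [A]. *)
Lemma comm_subgroup_subl S H A :
  normal_subgroup A -> S `<=` A -> comm_subgroup S H `<=` A.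
Proof.
move=> [sA nA] SA; apply: comm_subgroup_sub => // s t /SA As _.
rewrite /comm -2!mulgA; apply: subgroupM => //.
by rewrite [t * _]mulgA; apply: nA; exact: subgroupV.
Qed.

Lemma comm_subgroup_subr S H A :
  normal_subgroup A -> H `<=` A -> comm_subgroup S H `<=` A.
Proof.
move=> [sA nA] HA; apply: comm_subgroup_sub => // s t _ /HA At.
by apply: sA.2 => //; exact: nA.
Qed.

(** The preimage of [comm_subgroup S' H'] under [f] is a subgroup that contains the generators
    [comm s t]. *)
Lemma comm_subgroup_map f S S' H H' : {morph f : x y / x * y} ->
  (forall x, S x -> S' (f x)) -> (forall x, H x -> H' (f x)) ->
  forall x, comm_subgroup S H x -> comm_subgroup S' H' (f x).
Proof.
move=> fM fS fH; have fV := morph_inv fM.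
have sC := comm_subgroup_subgroup S' H'.
apply: (@comm_subgroup_sub _ _ [set x | comm_subgroup S' H' (f x)]).
  split=> [|x y Cx Cy] /=; first by rewrite morph_one //; exact: subgroup1.
  by rewrite fM fV; exact: sC.2.
move=> s t Ss Ht /=; rewrite /comm !fM !fV.
apply: sub_gen_smallest; exists (f s); first exact: fS.
by exists (f t) => //; exact: fH.
Qed.

Lemma prod_set_subgroup S H :
  normal_subgroup S -> subgroup H -> subgroup (prod_set S H).
Proof.
move=> [sS nS] sH; split.
  exists 1; first exact: subgroup1.
  by exists 1; [exact: subgroup1 | rewrite mulg1].
move=> _ _ [s Ss [t Ht <-]] [s' Ss' [t' Ht' <-]].
(* With [u = t * t'^-1], the quotient is [s * u * s'^-1 = (s * (u * s'^-1 * u^-1)) * u]. *)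
exists (s * ((t * t'^-1) * s'^-1 * (t * t'^-1)^-1)).
  by apply: subgroupM => //; apply: nS; exact: subgroupV.
exists (t * t'^-1); first exact: sH.2.
by rewrite -mulgA mulgVK invgM !mulgA.
Qed.

(** * The double lower central series of two normal subgroups *)

Section normal_pair.
Context (X Y : set K).
Context (normalX : normal_subgroup X) (normalY : normal_subgroup Y).

Lemma lcs_subgroup S n : subgroup S -> subgroup (lcs S n).
Proof. by case: n => [//|n] _; exact: comm_subgroup_subgroup. Qed.

Lemma lcs_map f S n : {morph f : x y / x * y} ->
  (forall x, S x -> S (f x)) -> forall x, lcs S n x -> lcs S n (f x).
Proof. by move=> fM fS; elim: n => //= n IHn; exact: comm_subgroup_map. Qed.

Lemma lcs_sub S n : normal_subgroup S -> lcs S n `<=` S.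
Proof. by case: n => [_ x //|n] nS; apply: (comm_subgroup_subl nS) => x. Qed.

Lemma double_lcs_map f : {morph f : x y / x * y} ->
  (forall x, X x -> X (f x)) -> (forall x, Y x -> Y (f x)) ->
  forall m n x, double_lcs X Y m n x -> double_lcs X Y m n (f x).
Proof.
move=> fM fX fY; elim=> [|m IHm]; first by case=> [//|n]; exact: lcs_map.
(* Degree (m+1, n+1) involves (m, n+1) and (m+1, n), hence an inner induction on [n] with [IHm]
   available for every [n]. *)
elim=> [|n IHn]; first exact: lcs_map.
rewrite double_lcsSS => _ [s Ss [t Ht <-]]; rewrite fM.
exists (f s); first exact: (comm_subgroup_map fM fX (IHm n.+1) Ss).
by exists (f t) => //; exact: (comm_subgroup_map fM fY IHn Ht).
Qed.

Lemma conj_morph (k : K) : {morph (fun x => k * x * k^-1) : x y / x * y}.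
Proof. by move=> x y; rewrite !mulgA mulgVK. Qed.

Lemma double_lcs_conj m n k x :
  double_lcs X Y m n x -> double_lcs X Y m n (k * x * k^-1).
Proof.
exact: (double_lcs_map (conj_morph k) (normalX.2 k) (normalY.2 k)).
Qed.

(** When both indices are positive, the product of the two commutator subgroups is a subgroup
    because the left one is stable under conjugation. *)
Lemma double_lcs_subgroup m n : subgroup (double_lcs X Y m n).
Proof.
case: m n => [|m] [|n] //.
- exact: lcs_subgroup normalY.1.
- exact: lcs_subgroup normalX.1.
rewrite double_lcsSS.
apply: prod_set_subgroup; last exact: comm_subgroup_subgroup.
split=> [|k x]; first exact: comm_subgroup_subgroup.
apply: (comm_subgroup_map (conj_morph k)); first exact: normalX.2.
by move=> y; exact: double_lcs_conj.
Qed.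

(** The left factor is a commutator subgroup of the normal [X]; the right one, [[Y, K_{m+1,n}]], is
    handled by induction on [n]. *)
Lemma double_lcs_subX m n : double_lcs X Y m.+1 n `<=` X.
Proof.
elim: n => [|n IHn]; first exact: lcs_sub.
rewrite double_lcsSS => _ [s Ss [t Ht <-]].
apply: subgroupM; first exact: normalX.1.
  exact: comm_subgroup_subl Ss.
exact: comm_subgroup_subr Ht.
Qed.

Lemma double_lcs_subY m n : double_lcs X Y m n.+1 `<=` Y.
Proof.
elim: m => [|m IHm]; first exact: lcs_sub.
rewrite double_lcsSS => _ [s Ss [t Ht <-]].
apply: subgroupM; first exact: normalY.1.
  exact: comm_subgroup_subr Ss.
exact: comm_subgroup_subl Ht.
Qed.

End normal_pair.

Lemma double_lcsz_nat (X Y : set K) (m n : nat) :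
  double_lcsz X Y m%:Z%R n%:Z%R = double_lcs X Y m n.
Proof. by rewrite /double_lcsz !Order.POrderTheory.max_r. Qed.

End double_lower_central_series.

(** * Actions by automorphisms and the two filtrations *)

Section group_action.
Context {M K : groupType} (act : M -> K -> K) (X Y : set K).
Context (normalX : normal_subgroup X) (normalY : normal_subgroup Y).
Context (act1 : forall k, act 1%g k = k).
Context (actM : forall g h k, act (g * h)%g k = act g (act h k)).
Context (act_morph : forall h, {morph act h : x y / (x * y)%g}).
Local Open Scope group_scope.

Lemma actK h : cancel (act h) (act h^-1).
Proof. by move=> k; rewrite -actM mulVg act1. Qed.

Lemma actVK h : cancel (act h^-1) (act h).
Proof. by move=> k; rewrite -actM mulgV act1. Qed.

(** This turns the equalities in [goeritz] into the stability under [h] and [h^-1] that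
    [double_lcs_map] takes as input. *)
Lemma act_image_eq h (A : set K) :
  act h @` A = A <-> forall x, A x -> A (act h x) /\ A (act h^-1 x).
Proof.
split=> [hA x Ax|hA].
  split; first by rewrite -hA; exists x.
  by move: Ax; rewrite -{1}hA => -[y Ay <-]; rewrite actK.
apply/seteqP; split=> [_ [x /hA[Ahx _] <-] //|x /hA[_ Ahx]].
by exists (act h^-1 x) => //; exact: actVK.
Qed.

(** Here [act h x] is the product of [act_comm h x], which lies in [S], and [x]. *)
Lemma act_comm_sub_stable h (S A : set K) : subgroup A -> S `<=` A ->
  act_comm_sub act h A S -> forall x, A x -> A (act h x).
Proof.
move=> sA SA hA x Ax; rewrite -(mulgVK x (act h x)).
by apply: subgroupM => //; exact/SA/hA.
Qed.

Lemma goeritz_double_lcs h i j k : goeritz act X Y h ->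
  double_lcs X Y i j k ->
  double_lcs X Y i j (act h k) /\ double_lcs X Y i j (act h^-1 k).
Proof.
move=> [/act_image_eq hX /act_image_eq hY] Kk.
by split; apply: double_lcs_map => // x; first [case/hX | case/hY].
Qed.

(** The indices [m + i] and [n + j] are nonnegative, so the truncation in [double_lcsz] has no
    effect. *)
Lemma int_filtration_natP h (m n : nat) :
  int_filtration act X Y m%:Z%R n%:Z%R h <->
  forall i j, act_comm_sub act h (double_lcs X Y i j)
                (double_lcs X Y (m + i) (n + j)) /\
              act_comm_sub act h^-1 (double_lcs X Y i j)
                (double_lcs X Y (m + i) (n + j)).
Proof.
by split=> hM i j; have := hM i j; rewrite -!PoszD !double_lcsz_nat.
Qed.

Lemma int_filtration_goeritz h (m n : nat) :
  int_filtration act X Y m%:Z%R n%:Z%R h -> goeritz act X Y h.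
Proof.
move=> /int_filtration_natP hM; split; apply/act_image_eq => x Ax.
(* [X] is [double_lcs X Y 1 0], and [addn1] exposes the successor required by [double_lcs_subX]. *)
- have := hM 1%N 0%N; rewrite addn1 => -[hX hVX].
  have KX := double_lcs_subX normalX.
  split; first exact: (act_comm_sub_stable normalX.1 (@KX _ _ _) hX).
  exact: (act_comm_sub_stable normalX.1 (@KX _ _ _) hVX).
- have := hM 0%N 1%N; rewrite addn1 => -[hY hVY].
  have KY := double_lcs_subY normalY.
  split; first exact: (act_comm_sub_stable normalY.1 (@KY _ _ _) hY).
  exact: (act_comm_sub_stable normalY.1 (@KY _ _ _) hVY).
Qed.

Lemma int_filtration_nat m n :
  int_filtration act X Y m%:Z%R n%:Z%R = goeritz_filtration act X Y m n.
Proof.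
apply/seteqP; split=> [h hM|h [hG hK]].
  split; first exact: int_filtration_goeritz hM.
  by move/int_filtration_natP: hM => hM i j; case: (hM i j).
apply/int_filtration_natP => i j; split; first exact: hK.
move=> k Kk; rewrite /act_comm.
have -> : act h^-1 k * k^-1 = act h^-1 (act_comm act h k)^-1.
  (* The [k] under the inverse becomes [act h^-1 (act h k)], so that [act h^-1] factors out. *)
  rewrite -[X in _ * X^-1](actK h) -(morph_inv (act_morph _)) -act_morph.
  by rewrite /act_comm invgM invgK.
apply: (goeritz_double_lcs hG _).2; apply: subgroupV; last exact: hK.
exact: double_lcs_subgroup.
Qed.

(** For [h] in [goeritz], both [act h k] and [k] lie in the subgroup K_{i,j}, hence so does their
    quotient. *)
Lemma goeritz_filtration00 : goeritz_filtration act X Y 0 0 = goeritz act X Y.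
Proof.
apply/seteqP; split=> [h [] //|h hG]; split=> // i j k Kk.
apply: (double_lcs_subgroup normalX normalY i j).2 => //.
by case: (goeritz_double_lcs hG Kk).
Qed.

End group_action.

Theorem proposition4p7 (R : realType) (g : nat)
    (D : set (S3 R)) (disk_D : is_disk D) (sub_D : D `<=` splitting_surface g)
    (O : set (planar_chart R (surface g D)))
    (orient_O : orientation (surface_boundary g D) O)
    (pt : surface g D) (bd_pt : surface_boundary g D pt) :
  let act : mcg (surface_boundary g D) O -> pi1 R pt -> pi1 R pt :=
    mcg_act bd_pt in
  let X := Xbar pt in
  let Y := Ybar pt in
  (forall m n : nat,
    int_filtration act X Y m%:Z n%:Z = goeritz_filtration act X Y m n) /\
  int_filtration act X Y 0 0 = goeritz_filtration act X Y 0 0 /\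
  goeritz_filtration act X Y 0 0 = goeritz act X Y.
Proof.
move=> act X Y.
(* [Xbar] and [Ybar] are defined as kernels of the maps that the inclusions into the two
   handlebodies induce on [pi1]. *)
have nX : normal_subgroup X by apply: kernel_normal; exact: pi1_mapM.
have nY : normal_subgroup Y by apply: kernel_normal; exact: pi1_mapM.
have act1 : forall k, act 1%g k = k by exact: mcg_act1.
have actM : forall h k a, act (h * k)%g a = act h (act k a).
  exact: mcg_actM.
have act_morph : forall h, {morph act h : x y / (x * y)%g}.
  exact: mcg_act_mul.
split; last split.
- by move=> m n; exact: int_filtration_nat.
- exact: (int_filtration_nat nX nY act1 actM act_morph 0 0).
- exact: (goeritz_filtration00 nX nY act1 actM act_morph).
Qed.
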